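(* Let $d\ge2$ and let $H$ be a hypergraph of separated $d$-intervals. Then $\tau(H)\le(d^2-d)\,\nu(H)$.
   Context: Fix $d$ pairwise disjoint copies $L_1,\dots,L_d$ of the real line. A separated $d$-interval is a set of the form $h=h^1\cup\dots\cup h^d$ where each $h^j$ is either empty or a closed interval in $L_j$. A hypergraph of separated $d$-intervals is a finite family $H$ of separated $d$-intervals, regarded as a hypergraph whose vertices are the points of $L_1\cup\dots\cup L_d$. A matching is a set of pairwise disjoint edges and $\nu(H)$ is its maximum size; a cover is a set of points meeting every edge and $\tau(H)$ is the minimum size of a cover. *)

(* Defs.v *)
From Stdlib Require Import Reals.
From mathcomp Require Import all_boot.
Set Implicit Arguments. Unset Strict Implicit. Unset Printing Implicit Defensive.

(* The d disjoint copies L_0,...,L_{d-1} of the real line: a point of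
   L_1 u ... u L_d is a pair (j, x) with j : 'I_d the line and x : R. *)
Definition point (d : nat) : Type := ('I_d * R)%type.

(* A separated d-interval: for each line j, a pair (a_j, b_j) describing the
   closed interval h^j = [a_j, b_j] = {x | a_j <= x <= b_j} in L_j.
   When a_j > b_j this set is empty, so every choice "empty or a closed
   interval" in each line is represented. *)
Definition sdint (d : nat) : Type := 'I_d -> (R * R)%type.

Definition in_sdint (d : nat) (h : sdint d) (p : point d) : Prop :=
  Rle (fst (h p.1)) p.2 /\ Rle p.2 (snd (h p.1)).

Definition sd_disjoint (d : nat) (h h' : sdint d) : Prop :=
  ~ (exists p : point d, in_sdint h p /\ in_sdint h' p).

(* A hypergraph: a finite family of separated d-intervals, indexed by 'I_m. *)
Definition is_matching (d m : nat) (H : 'I_m -> sdint d) (M : {set 'I_m}) : Prop :=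
  forall i j, i \in M -> j \in M -> i != j -> sd_disjoint (H i) (H j).

Definition is_nu (d m : nat) (H : 'I_m -> sdint d) (nu : nat) : Prop :=
  (exists M : {set 'I_m}, is_matching H M /\ #|M| = nu) /\
  (forall M : {set 'I_m}, is_matching H M -> #|M| <= nu).

Definition is_cover (d m : nat) (H : 'I_m -> sdint d) (C : seq (point d)) : Prop :=
  forall i : 'I_m, exists p : point d, List.In p C /\ in_sdint (H i) p.

(* Main.v *)
Require Import Defs.
From Stdlib Require Import Reals Classical.
From mathcomp Require Import all_boot.
From mathcomp Require Import all_order all_algebra.
From mathcomp Require Import zify ring lra.
Set Implicit Arguments. Unset Strict Implicit. Unset Printing Implicit Defensive.
Import Order.TTheory GRing.Theory Num.Theory.

(* Put [k = (d - 1) nu] and suppose that no choice of [k] points on each line is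
   a cover.  Give every edge the weight [wt e p], its distance from the points
   [p].  A discrete Poincare-Miranda theorem (Kuhn's cubical lemma) yields a
   configuration [p] such that, up to a small error, the [s]-th point of line [j]
   has a proportion [s / (k + 1)] of the weight of line [j] on its left.  Hence
   each of the [k + 1] gaps on each line carries at most a proportion
   [1 / (k + 1)] of the total weight, up to that error.  Sending each unhit edge to
   the gaps that contain its pieces turns the weights into a fractional matching,
   of total weight greater than [k], of a [d]-partite hypergraph of rank at most
   [d].  By a theorem of Furedi such a hypergraph satisfies [nu* <= (d - 1) nu],
   so it has a matching of more than [nu] edges, and edges with disjoint sets of
   gaps are disjoint.

   Kuhn's lemma is proved by a mod 2 cup product of the coboundaries of the
   labels: its sum over the grid is [1] by Stokes' theorem and induction. *)

(** * Kuhn's cubical lemma *)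

Section Kuhn.
Local Open Scope ring_scope.
Variable I : finType.
Local Notation pt := {ffun I -> nat}.

Definition upd (x : pt) (a : I) (t : nat) : pt :=
  [ffun c => if c == a then t else x c].
Definition step (x : pt) (a : I) : pt := upd x a (x a).+1.
Definition diff (a : I) (f : pt -> 'F_2) (x : pt) : 'F_2 := f (step x a) - f x.

Lemma updE x a t c : upd x a t c = if c == a then t else x c.
Proof. by rewrite ffunE. Qed.

Lemma stepE x a c : step x a c = (x c + (c == a))%N.
Proof. by rewrite updE; case: eqP => [->|_]; rewrite ?addn1 ?addn0. Qed.

Lemma upd_upd x a s t : upd (upd x a s) a t = upd x a t.
Proof. by apply/ffunP=> c; rewrite !updE; case: eqP. Qed.

Lemma updC x a b s t : a != b -> upd (upd x a s) b t = upd (upd x b t) a s.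
Proof.
move=> ab; apply/ffunP=> c; rewrite !updE.
by case: (eqVneq c b) => // ->; rewrite eq_sym (negbTE ab).
Qed.

Lemma stepC x a b : step (step x a) b = step (step x b) a.
Proof. by apply/ffunP=> c; rewrite !stepE; lia. Qed.

Lemma diffC a c f x : diff a (diff c f) x = diff c (diff a f) x.
Proof. by rewrite /diff stepC; ring. Qed.

Lemma diff_sum (P : pred I) a (F : I -> pt -> 'F_2) x :
  diff a (fun y => \sum_(c | P c) F c y) x = \sum_(c | P c) diff a (F c) x.
Proof. by rewrite /diff sumrB. Qed.

(** In characteristic 2 the terms of [(a, c)] and [(c, a)] cancel; [enum_rank] selects one from each
    such pair. *)
Lemma sum_sym_offdiag (A : {set I}) (h : I -> I -> 'F_2) :
  (forall a c, h a c = h c a) ->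
  \sum_(a in A) \sum_(c in A :\ a) h a c = 0.
Proof.
move=> hC; pose lt (a c : I) := (enum_rank a < enum_rank c)%N.
have splitE a : \sum_(c in A :\ a) h a c
    = \sum_(c in A | lt a c) h a c + \sum_(c in A | lt c a) h a c.
  rewrite (bigID (lt a)) /=; congr (_ + _); apply: eq_bigl => c;
    rewrite !inE /lt -(inj_eq enum_rank_inj) -val_eqE /=;
    by case: (c \in A); rewrite ?andbF //= andbT; lia.
rewrite (eq_bigr _ (fun a _ => splitE a)) big_split /=.
rewrite [X in _ + X](exchange_big_dep (mem A)) /=; last by move=> ? ? _ /andP[].
rewrite -big_split big1 //= => a aA.
have ch2 : 2%N \in [pchar 'F_2] by rewrite pchar_Fp.
rewrite -[RHS](addrr_pchar2 ch2 (\sum_(c in A | lt a c) h a c)); congr (_ + _).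
by apply: eq_big => [c|c _]; rewrite ?aA.
Qed.

(* Cubical analogue of the cup product of the coboundaries of the functions in
   [bs], evaluated on the face spanned at [x] by the directions in [A]. *)
Fixpoint cup (bs : seq (pt -> 'F_2)) (A : {set I}) (x : pt) : 'F_2 :=
  if bs is b :: bs' then
    \sum_(a in A) diff a b x * cup bs' (A :\ a) (step x a)
  else 1.

(** Product rule: the [a]-difference of [b * g] is [diff a b x * g (step x a) + b x * diff a g x],
    and closedness kills the sum of the second terms. *)
Lemma cup_exact_of_closed b bs (A : {set I}) x :
  \sum_(a in A) diff a (cup bs (A :\ a)) x = 0 ->
  cup (b :: bs) A x =
    \sum_(a in A) diff a (fun y => b y * cup bs (A :\ a) y) x.
Proof.
move=> closed.
transitivity (cup (b :: bs) A x + b x * \sum_(a in A) diff a (cup bs (A :\ a)) x).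
  by rewrite closed mulr0 addr0.
rewrite mulr_sumr /= -big_split.
by apply: eq_bigr => a _ /=; rewrite /diff; ring.
Qed.

(** By induction the sum consists of mixed second differences, symmetric in the two directions,
    which cancel mod 2. *)
Lemma cup_closed bs (A : {set I}) x : \sum_(a in A) diff a (cup bs (A :\ a)) x = 0.
Proof.
elim: bs A x => [|b bs IH] A x; first by rewrite big1 // => a _; rewrite /diff subrr.
pose h a c := diff a (diff c (fun y => b y * cup bs (A :\ a :\ c) y)) x.
rewrite -[RHS](@sum_sym_offdiag A h).
  apply: eq_bigr => a aA.
  rewrite /h -(diff_sum (mem (A :\ a))) /diff.
  by rewrite !(cup_exact_of_closed _ (IH _ _)).
move=> a c; rewrite /h diffC.
by rewrite !setDDl [[set a] :|: _]setUC.
Qed.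

Lemma cup_exact b bs (A : {set I}) x :
  cup (b :: bs) A x = \sum_(a in A) diff a (fun y => b y * cup bs (A :\ a) y) x.
Proof. exact/cup_exact_of_closed/cup_closed. Qed.

(** * Grid sums and Stokes' theorem *)

Variable n : nat.

Fixpoint boxsum (l : seq I) (f : pt -> 'F_2) (x : pt) : 'F_2 :=
  if l is a :: l' then \sum_(t < n) boxsum l' f (upd x a t) else f x.

Lemma eq_boxsum l f g x : f =1 g -> boxsum l f x = boxsum l g x.
Proof.
move=> fg; elim: l x => [|a l IH] x /=; first exact: fg.
by apply: eq_bigr => t _; apply: IH.
Qed.

Lemma boxsum_sum (J : finType) (P : pred J) l (F : J -> pt -> 'F_2) x :
  boxsum l (fun y => \sum_(c | P c) F c y) x = \sum_(c | P c) boxsum l (F c) x.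
Proof.
elim: l x => [|a l IH] x //=.
by rewrite exchange_big; apply: eq_bigr => t _; apply: IH.
Qed.

Lemma boxsum0 l x : boxsum l (fun=> 0) x = 0.
Proof. by elim: l x => [|a l IH] x //=; rewrite big1. Qed.

Lemma boxsum_upd l f x c t : c \notin l ->
  boxsum l f (upd x c t) = boxsum l (fun y => f (upd y c t)) x.
Proof.
elim: l x => [|a l IH] x //=; rewrite inE negb_or => /andP[ca cl].
by apply: eq_bigr => s _; rewrite updC // IH.
Qed.

Lemma boxsum_diff l c g x : uniq l -> c \in l ->
  boxsum l (diff c g) x =
  boxsum (rem c l) (fun y => g (upd y c n) - g (upd y c 0%N)) x.
Proof.
elim: l x => [|a l IH] x //= /andP[al ul].
rewrite inE; case: (eqVneq a c) => [<- _|ac /= cl].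
- rewrite (eq_bigr _ (fun (t : 'I_n) _ => boxsum_upd (diff a g) x t al)).
  rewrite -boxsum_sum; apply: eq_boxsum => y.
  elim: n => [|k IHk]; first by rewrite big_ord0 subrr.
  rewrite big_ord_recr /= IHk /diff /step upd_upd updE eqxx.
  by ring.
- by apply: eq_bigr => t _; apply: IH.
Qed.

Lemma boxsum_neq0 l f x : boxsum l f x != 0 ->
  exists2 y, f y != 0 & forall c, if c \in l then (y c < n)%N else y c == x c.
Proof.
elim: l x => [|a l IH] x /=; first by exists x.
move=> s0; have [t] : exists t : 'I_n, boxsum l f (upd x a t) != 0.
  apply/existsP; apply: contraNT s0; rewrite negb_exists => /forallP h.
  by rewrite big1 // => t _; apply/eqP; have := h t; rewrite negbK.
case/IH=> y fy yP; exists y => // c; rewrite inE.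
have := yP c; case: (c \in l); rewrite ?orbT // orbF updE.
by case: (c == a) => // /eqP->.
Qed.

Arguments boxsum : simpl never.

(** * Labels with Kuhn's boundary conditions *)

Variable b : I -> pt -> bool.
Hypothesis b0 : forall a (x : pt), x a = 0%N -> b a x = false.
Hypothesis bn : forall a (x : pt), x a = n -> b a x = true.

Local Notation bF := (fun a (x : pt) => (b a x)%:R : 'F_2).

(** Label [c] is constant on the face through [x], and steps in directions of [A] stay in that face,
    so the factor of label [c] always vanishes. *)
Lemma cup_face0 (l : seq I) (A : {set I}) c (x : pt) : c \in l -> c \notin A -> x c = 0%N \/ x c = n ->
  cup (map bF l) A x = 0.
Proof.
elim: l A x => [|a l IH] A x //=; rewrite inE => cl cA xc.
rewrite big1 // => e eA.
have ec : (c == e) = false by apply: contraNF cA => /eqP->.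
have sc : step x e c = x c by rewrite stepE ec addn0.
case/orP: cl => [/eqP ca|cl].
  suff -> : diff e (bF a) x = 0 by rewrite mul0r.
  by rewrite /diff -ca; case: xc => xc;
    rewrite ?(b0 xc) ?(bn xc) ?(b0 (etrans sc xc)) ?(bn (etrans sc xc)) subrr.
by rewrite IH ?mulr0 ?sc // !inE negb_and cA orbT.
Qed.

(** Stokes turns the sum into face differences. A direction [c] in [l] contributes nothing, as label
    [c] is among the remaining factors; in direction [a], label [a] is 1 on the far face and 0 on
    the near one, which leaves the case of [l]. *)
Lemma boxsum_cup l x : uniq l ->
  boxsum l (cup (map bF l) [set c in l]) x = 1.
Proof.
elim: l x => [|a l IH] x ul //.
have [al ul'] : a \notin l /\ uniq l by apply/andP.
have Ea : [set c in a :: l] :\ a = [set c in l].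
  by apply/setP=> c; rewrite !inE; case: eqP => // ->; rewrite (negbTE al).
rewrite (eq_boxsum _ _ (cup_exact (bF a) (map bF l) _)) boxsum_sum.
rewrite (bigD1 a) /=; last by rewrite inE mem_head.
rewrite [X in _ + X]big1 ?addr0; last first.
  move=> c; rewrite !inE => /andP[cal ca]; rewrite (boxsum_diff _ _ ul) ?inE //.
  rewrite -[RHS](boxsum0 (rem c (a :: l)) x); apply: eq_boxsum => y.
  have cl : c \in l by move: cal; rewrite (negbTE ca).
  by rewrite !(cup_face0 cl) ?mulr0 ?subrr // ?inE ?eqxx // updE eqxx; auto.
rewrite (boxsum_diff _ _ ul) ?mem_head //= eqxx Ea.
rewrite -[RHS](IH (upd x a n)) // boxsum_upd //; apply: eq_boxsum => y.
by rewrite (bn (x := upd y a n)) ?(b0 (x := upd y a 0%N)) ?updE ?eqxx // mul1r mul0r subr0.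
Qed.

Definition in_cell (y z : pt) := forall c, (y c <= z c <= (y c).+1)%N.

(** A nonzero term of the cup is a monotone path inside the face, along whose successive edges the
    successive labels change. *)
Lemma cup_neq0 l (A : {set I}) y : cup (map bF l) A y != 0 ->
  forall a, a \in l -> exists z z', [/\ b a z, ~~ b a z' &
    forall c, (y c <= z c <= y c + (c \in A))%N /\ (y c <= z' c <= y c + (c \in A))%N].
Proof.
elim: l A y => [|e l IH] A y //= s0.
have [a /and3P[aA d0 c0]] : exists a,
    [&& a \in A, diff a (bF e) y != 0 & cup (map bF l) (A :\ a) (step y a) != 0].
  apply/existsP; apply: contraNT s0; rewrite negb_exists => /forallP h.
  rewrite big1 // => a aA; apply/eqP; rewrite mulf_eq0.
  by have := h a; rewrite aA /= negb_and !negbK.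
move=> f; rewrite inE => /orP[/eqP ->|fl].
  have yc c : (y c <= y c <= y c + (c \in A))%N by lia.
  have sc c : (y c <= step y a c <= y c + (c \in A))%N.
    by rewrite stepE; case: eqP => [->|_]; rewrite ?aA; lia.
  move: d0; rewrite /diff.
  case Es: (b e (step y a)); case Ey: (b e y); rewrite ?subrr ?eqxx // => _.
    by exists (step y a), y; rewrite Es Ey.
  by exists y, (step y a); rewrite Es Ey.
have [z [z' [bz bz' zz']]] := IH _ _ c0 f fl.
exists z, z'; split=> // c; have := zz' c; rewrite stepE !inE.
by case: eqP => [->|_] /=; rewrite ?aA; lia.
Qed.

Theorem kuhn : exists2 y : pt, (forall c, y c < n)%N &
  forall a, exists z z', [/\ b a z, ~~ b a z', in_cell y z & in_cell y z'].
Proof.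
have := @boxsum_cup (enum I) [ffun=> 0%N] (enum_uniq I).
set S := [set c in enum I]; set f := cup _ S => /eqP fE.
have /boxsum_neq0[y fy yn] : boxsum (enum I) f [ffun=> 0%N] != 0.
  by rewrite (eqP fE) oner_neq0.
exists y => [c|a]; first by have := yn c; rewrite mem_enum.
have [|z [z' [bz bz' zz']]] := cup_neq0 fy (a := a); first by rewrite mem_enum.
exists z, z'; split=> // c; have := zz' c; rewrite !inE mem_enum; lia.
Qed.

End Kuhn.

(** * Fractional matchings of partite hypergraphs *)

Section Furedi.
Local Open Scope ring_scope.
Variables (d : nat) (J E : finType) (vert : E -> {set 'I_d * J}).
Local Notation V := ('I_d * J)%type.
Hypothesis d_ge2 : (1 < d)%N.
Hypothesis vert_neq0 : forall e, vert e != set0.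
Hypothesis vert_partite : forall e, {in vert e &, injective fst}.

Implicit Types (w c : E -> rat) (e : E) (v : V).

Definition load w v := \sum_(e | v \in vert e) w e.
Definition supp w := [set e | w e != 0].
Definition saturated w := [set v | load w v == 1].
Definition fractional_matching w :=
  (forall e, 0 <= w e) /\ (forall v, load w v <= 1).
(** The factor exceeds the number of vertices, so the comparison is lexicographic, with the support
    first. *)
Definition measure w := (#|supp w| * #|{: V}|.+1 + #|~: saturated w|)%N.

Lemma loadD w c t v : load (fun e => w e + t * c e) v = load w v + t * load c v.
Proof. by rewrite /load big_split mulr_sumr. Qed.

Lemma load_ge w e v : (forall e, 0 <= w e) -> v \in vert e -> w e <= load w v.
Proof. by move=> w0 ve; rewrite /load (bigD1 e) //= lerDl sumr_ge0. Qed.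

Lemma card_vertI e (B : {set V}) : (#|vert e :&: B| <= d)%N.
Proof.
rewrite -(card_in_imset (f := fst)).
  by apply: leq_trans (max_card _) _; rewrite card_ord.
by move=> u v /setIP[ue _] /setIP[ve _]; apply: vert_partite ue ve.
Qed.

Lemma measure_supp w w' :
  (#|supp w'| < #|supp w|)%N -> (measure w' < measure w)%N.
Proof.
move=> lt; rewrite /measure.
have : (#|~: saturated w'| <= #|{: V}|)%N by apply: max_card.
by move: lt #|{: V}| #|~: saturated w'| #|~: saturated w| => lt N a b; nia.
Qed.

(* Moving along [c] as far as possible makes a new constraint tight and keeps
   the tight ones, so that finitely many moves lead to an extreme point. *)
Lemma fractional_matching_move w c : fractional_matching w ->
  (exists e, c e != 0) -> (forall e, w e = 0 -> c e = 0) ->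
  (forall v, v \in saturated w -> load c v = 0) -> 0 <= \sum_e c e ->
  exists w', [/\ fractional_matching w', \sum_e w e <= \sum_e w' e,
    supp w' \subset supp w & (measure w' < measure w)%N].
Proof.
move=> [w0 w1] [e1 ce1] csupp csat csum.
(* [al] is the slack of each constraint and [be] its rate of change along [c]. *)
pose al (i : E + V) := match i with inl e => w e | inr v => 1 - load w v end.
pose be (i : E + V) := match i with inl e => c e | inr v => - load c v end.
have al_ge0 i : 0 <= al i by case: i => [e|v] /=; rewrite ?subr_ge0.
have al_be i : al i = 0 -> be i = 0.
  case: i => [e|v] /=; first exact: csupp.
  by move=> /eqP; rewrite subr_eq0 eq_sym => vs; rewrite csat ?oppr0 // inE.
(* If no entry of [c] is negative, the load grows at any vertex of [e1]. *)
have [i0 bi0] : exists i, be i < 0.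
  have [/existsP[e ce]|/existsPn h] := boolP [exists e, c e < 0]; first by exists (inl e).
  have c0 e : 0 <= c e by rewrite leNgt h.
  have /set0Pn[v ve] := vert_neq0 e1; exists (inr v) => /=.
  rewrite oppr_lt0; apply: lt_le_trans (load_ge c0 ve).
  by rewrite lt_def ce1 c0.
have [i bi imin] := arg_minP (fun i => al i / - be i) (P := fun i => be i < 0) bi0.
(* The first time at which some slack runs out. *)
set t := al i / - be i in imin.
have nbi : 0 < - be i by rewrite oppr_gt0.
have t0 : 0 <= t by rewrite divr_ge0 // ltW.
have new_ge0 k : 0 <= al k + t * be k.
  have [bk|bk] := ltP (be k) 0; last by rewrite addr_ge0 // mulr_ge0.
  have := imin k bk; rewrite ler_pdivlMr ?oppr_gt0 //.
  by rewrite mulrN; lra.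
have new_i : al i + t * be i = 0.
  have bi0' : be i != 0 by rewrite lt_eqF.
  by rewrite /t; field.
have al_i : al i != 0 by apply: contraTneq bi => /al_be->; rewrite ltxx.
exists (fun e => w e + t * c e).
have ssupp : supp (fun e => w e + t * c e) \subset supp w.
  apply/subsetP=> e; rewrite !inE; apply: contra => /eqP we.
  by rewrite we (csupp _ we) mulr0 addr0.
have ssat : saturated w \subset saturated (fun e => w e + t * c e).
  apply/subsetP=> v vs; rewrite inE loadD (csat _ vs) mulr0 addr0.
  by move: vs; rewrite inE.
split=> //.
- split=> [e|v]; first exact: (new_ge0 (inl e)).
  by have := new_ge0 (inr v); rewrite /= loadD; lra.
- by rewrite big_split /= -mulr_sumr lerDl mulr_ge0.
- case: i {bi imin nbi new_ge0} t t0 new_i al_i ssupp ssat => [e|v] /= t _ new_i al_i ssupp ssat.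
    apply/measure_supp/proper_card; rewrite properE ssupp.
    by apply/subsetPn; exists e; rewrite !inE ?new_i ?eqxx.
  rewrite /measure -addnS leq_add ?leq_mul ?subset_leq_card //.
  apply/proper_card; rewrite properE setCS ssat /=.
  apply/subsetPn; exists v; rewrite !inE.
    by move: al_i; rewrite subr_eq0 eq_sym.
  by rewrite negbK loadD; apply/eqP; lra.
Qed.

(** Left kernel vectors are the directions on the support that fix all saturated loads; independent
    rows mean that [w] is an extreme point. *)
Definition incidence w : 'M[rat]_(#|supp w|, #|saturated w|) :=
  \matrix_(i, j) (enum_val j \in vert (enum_val i))%:R.

Lemma not_row_free_move w : ~~ row_free (incidence w) ->
  exists c, [/\ exists e, c e != 0, forall e, w e = 0 -> c e = 0 &
    forall v, v \in saturated w -> load c v = 0].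
Proof.
rewrite -kermx_eq0 => /rowV0Pn[r /sub_kermxP rB r0].
pose c e := \sum_(i < #|supp w|) r 0 i * (enum_val i == e)%:R.
have cE i : c (enum_val i) = r 0 i.
  rewrite /c (bigD1 i) //= eqxx mulr1 big1 ?addr0 // => k ki.
  by rewrite (inj_eq enum_val_inj) (negbTE ki) mulr0.
exists c; split.
- have /rV0Pn[i ri] := r0.
  by exists (enum_val i); rewrite cE.
- move=> e we; rewrite /c big1 // => i _; case: eqP => [ie|_]; last by rewrite mulr0.
  by have := enum_valP i; rewrite ie inE we eqxx.
- move=> v vs; rewrite /load /c exchange_big /=.
  have := congr1 (fun M : 'rV_#|saturated w| => M 0 (enum_rank_in vs v)) rB.
  rewrite !mxE => rBv; rewrite -[RHS]rBv; apply: eq_bigr => i _.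
  rewrite mxE enum_rankK_in // -mulr_sumr; congr (_ * _).
  rewrite big_mkcond (bigD1 (enum_val i)) //= eqxx big1 ?addr0 => [|e ei].
    by case: ifP.
  by rewrite eq_sym (negbTE ei); case: ifP.
Qed.

(** Summing the loads over the vertices of [e] counts [e] itself [#|vert e|] times and every other
    edge meeting it at least once. *)
Lemma sum_meeting w e : fractional_matching w ->
  \sum_(e' | ~~ [disjoint vert e & vert e']) w e' <=
    #|vert e|%:R - (#|vert e|%:R - 1) * w e.
Proof.
move=> [w0 w1].
have -> : #|vert e|%:R - (#|vert e|%:R - 1) * w e = #|vert e|%:R - #|vert e|%:R * w e + w e.
  by ring.
have vv : ~~ [disjoint vert e & vert e] by rewrite -setI_eq0 setIid.
rewrite (bigD1 e) //= addrC lerD2r lerBrDr.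
apply: (@le_trans _ _ (\sum_(v in vert e) load w v)); last first.
  by rewrite -sum1_card natr_sum; apply: ler_sum => v _; apply: w1.
rewrite /load (exchange_big_dep predT) //= [leRHS](bigD1 e) //= addrC.
apply: lerD; last first.
  rewrite (eq_bigl (mem (vert e))); last by move=> v; rewrite /= andbb.
  by rewrite sumr_const mulr_natl.
rewrite [leRHS](bigID (fun e' => ~~ [disjoint vert e & vert e'])) /= -[leLHS]addr0.
apply: lerD; last by do 2 apply: sumr_ge0 => ? _.
rewrite (eq_bigl _ _ (fun e' => andbC _ _)); apply: ler_sum => e' /andP[_].
rewrite -setI_eq0 => /set0Pn[v /setIP[ve ve']].
by rewrite (bigD1 v) ?ve //= lerDl sumr_ge0.
Qed.

Lemma natr_d_pred : (d.-1)%:R = d%:R - 1 :> rat.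
Proof. by rewrite -subn1 natrB // ltnW. Qed.

(* At an extreme point there are at most as many edges as saturated vertices.
   If all weights are below [1 / (d - 1)], then counting incidences shows that
   equality holds and that all vertices are saturated; as every edge meets every
   vertex class exactly once, the incidence matrix is then singular. *)
Lemma exists_heavy_edge w : fractional_matching w -> row_free (incidence w) ->
  supp w != set0 -> exists2 e, e \in supp w & 1 <= (d.-1)%:R * w e.
Proof.
move=> [w0 w1] rf S0; apply/exists_inP; apply: contraT => /exists_inPn light.
pose deg v := #|[set e in supp w | v \in vert e]|.
have card_le : (#|supp w| <= #|saturated w|)%N.
  by have := rank_leq_col (incidence w); rewrite (eqP rf).
have deg_ge v : v \in saturated w -> (d <= deg v)%N.
  rewrite inE => /eqP lv.
  have lE : load w v = \sum_(e in [set e in supp w | v \in vert e]) w e.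
    rewrite /load (bigID (mem (supp w))) /= [X in _ + X]big1 ?addr0.
      by apply: eq_bigl => e; rewrite !inE andbC.
    by move=> e /andP[_]; rewrite inE negbK => /eqP.
  have [deg0|/set0Pn[e1 e1P]] := eqVneq [set e in supp w | v \in vert e] set0.
    by move: lv; rewrite lE deg0 big_set0 => /eqP; rewrite eq_sym oner_eq0.
  have : (d.-1)%:R < (deg v)%:R :> rat.
    have -> : (d.-1)%:R = (d.-1)%:R * load w v by rewrite lv mulr1.
    rewrite lE mulr_sumr /deg -sum1_card natr_sum.
    apply: ltr_sum => [|e]; first by apply/hasP; exists e1; rewrite ?mem_index_enum.
    by rewrite inE => /andP[/light]; rewrite -ltNge.
  by rewrite ltr_nat; case: (d) d_ge2.
have count : (\sum_(v in saturated w) deg v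
    = \sum_(e in supp w) #|vert e :&: saturated w|)%N.
  rewrite /deg.
  under eq_bigr do rewrite -sum1_card.
  rewrite (exchange_big_dep (mem (supp w))) /=; last by move=> v e _; rewrite inE => /andP[].
  apply: eq_bigr => e eS; rewrite -sum1_card; apply: eq_bigl => v.
  by rewrite !inE in eS *; rewrite eS andbC.
have lb : (d * #|saturated w| <= \sum_(v in saturated w) deg v)%N.
  by rewrite mulnC -sum_nat_const; apply: leq_sum.
have [ub ubE] : (\sum_(e in supp w) #|vert e :&: saturated w| <= d * #|supp w|
    ?= iff [forall (e | e \in supp w), #|vert e :&: saturated w| == d])%N.
  rewrite mulnC -sum_nat_const; apply: leqif_sum => e _.
  by split; first exact: card_vertI.
have d0 : (0 < d)%N by exact: ltnW.
have cardE : #|supp w| = #|saturated w| by nia.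
have all_sat e j : e \in supp w -> exists2 u, u \in vert e :&: saturated w & u.1 = j.
  move=> eS; have /forall_inP/(_ e eS)/eqP cd :
      [forall (e | e \in supp w), #|vert e :&: saturated w| == d].
    by rewrite -ubE; apply/eqP; nia.
  have : j \in [set u.1 | u in vert e :&: saturated w].
    suff -> : [set u.1 | u in vert e :&: saturated w] = setT by rewrite inE.
    apply/eqP; rewrite eqEcard subsetT cardsT card_ord card_in_imset ?cd ?leqnn //.
    by move=> u v /setIP[ue _] /setIP[ve _]; apply: vert_partite ue ve.
  by case/imsetP=> u uP ->; exists u.
have rfull : row_full (incidence w) by rewrite /row_full (eqP rf) cardE.
pose j0 : 'I_d := Ordinal d0; pose j1 : 'I_d := Ordinal d_ge2.
(* The difference of the indicators of two vertex classes; it lies in the kernel because every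
   support edge meets each class once. *)
pose u : 'cV[rat]_#|saturated w| :=
  \col_i (((enum_val i).1 == j0)%:R - ((enum_val i).1 == j1)%:R).
have class_sum e j : e \in supp w ->
    \sum_(v in saturated w) (v \in vert e)%:R * (v.1 == j)%:R = 1 :> rat.
  move=> eS; have [x /setIP[xe xs] xj] := all_sat e j eS.
  rewrite (bigD1 x) //= xe xj eqxx mulr1 big1 ?addr0 // => v /andP[vs vx].
  case ve: (v \in vert e); rewrite ?mul0r // mul1r; case: eqP => // vj.
  by rewrite (vert_partite ve xe (etrans vj (esym xj))) eqxx in vx.
have Bu : incidence w *m u = 0.
  apply/colP=> i; rewrite !mxE.
  under eq_bigr do rewrite !mxE mulrBr.
  have enum_class_sum j : \sum_(k < #|saturated w|) (enum_val k \in vert (enum_val i))%:R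
      * ((enum_val k : V).1 == j)%:R = 1 :> rat.
    by rewrite -[RHS](class_sum _ j (enum_valP i)) [RHS]big_enum_val.
  by rewrite sumrB !enum_class_sum subrr.
have u0 : u = 0 by apply: (row_full_inj rfull); rewrite Bu mulmx0.
have /set0Pn[e eS] := S0.
have [x /setIP[xe xs] xj] := all_sat e j0 eS.
have := congr1 (fun M : 'cV_#|saturated w| => M (enum_rank_in xs x) 0) u0.
by rewrite !mxE enum_rankK_in // xj eqxx.
Qed.

(** At an extreme point a heavy edge joins the matching and the edges meeting it are dropped, at a
    cost of at most [d.-1]; otherwise a move lowers [measure] without losing total weight. *)
Theorem furedi_partite w : fractional_matching w ->
  exists M : {set E}, [/\ M \subset supp w,
    {in M &, forall e e', e != e' -> [disjoint vert e & vert e']} &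
    \sum_e w e <= (d.-1 * #|M|)%:R].
Proof.
have [k] := ubnP (measure w); elim: k w => // k IH w; rewrite ltnS => mw fw.
have [w0 w1] := fw.
have [S0|S0] := eqVneq (supp w) set0.
  exists set0; split; rewrite ?sub0set //; first by move=> e; rewrite inE.
  rewrite big1 ?ler0n // => e _; apply/eqP; apply: contraT => we.
  by have /setP/(_ e) := S0; rewrite !inE we.
have [rf|/not_row_free_move[c [c0 csupp csat]]] := boolP (row_free (incidence w)).
  have [e eS heavy] := exists_heavy_edge fw rf S0.
  pose w' e' := if [disjoint vert e & vert e'] then w e' else 0.
  have vv : ~~ [disjoint vert e & vert e] by rewrite -setI_eq0 setIid.
  have w'0 e' : 0 <= w' e' by rewrite /w'; case: ifP.
  have fw' : fractional_matching w'.
    split=> // v; apply: le_trans (w1 v); apply: ler_sum => e' _.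
    by rewrite /w'; case: ifP.
  have ssub : supp w' \subset supp w :\ e.
    apply/subsetP=> e'; rewrite !inE /w'; case: ifP; rewrite ?eqxx // => dd ->.
    by rewrite andbT; apply: contraNneq vv => ee; rewrite ee in dd.
  have /IH/(_ fw')[] : (measure w' < k)%N.
    apply: leq_trans mw; apply: measure_supp.
    by rewrite [ltnRHS](cardsD1 e) eS ltnS subset_leq_card.
  move=> M [Mw' Md Msum].
  have Me e' : e' \in M -> [disjoint vert e & vert e'].
    by move/(subsetP Mw'); rewrite inE /w'; case: ifP; rewrite ?eqxx.
  have eM : e \notin M by apply: contra vv => /Me.
  exists (e |: M); split.
  - rewrite subUset sub1set eS /=; apply: subset_trans Mw' _.
    by apply: subset_trans ssub _; apply: subsetDl.
  - move=> e1 e2; rewrite !inE => /orP[/eqP->|e1M] /orP[/eqP->|e2M] ne.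
    + by rewrite eqxx in ne.
    + exact: Me.
    + by rewrite disjoint_sym; apply: Me.
    + exact: Md.
  - rewrite cardsU1 eM mulnDr muln1 natrD.
    rewrite (bigID (fun e' => ~~ [disjoint vert e & vert e'])) /=; apply: lerD.
      apply: le_trans (sum_meeting e fw) _; rewrite natr_d_pred.
      have r1 : 1 <= #|vert e|%:R :> rat by rewrite ler1n card_gt0.
      have : (#|vert e| <= d)%N by have := card_vertI e setT; rewrite setIT.
      (* With [d] vertices the heaviness of [e] saves 1; with fewer, [#|vert e|] is already at most
         [d - 1]. *)
      rewrite leq_eqVlt => /orP[/eqP->|].
        by move: heavy; rewrite natr_d_pred; lra.
      rewrite -(@ler_nat rat) -natr1 => rd.
      by have : 0 <= (#|vert e|%:R - 1) * w e; [rewrite mulr_ge0 ?subr_ge0|lra].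
    apply: le_trans Msum; rewrite big_mkcond; apply: ler_sum => e' _.
    by rewrite negbK /w'.
have [c' [c'0 c'supp c'sat c'sum]] : exists c', [/\ exists e, c' e != 0,
    forall e, w e = 0 -> c' e = 0,
    forall v, v \in saturated w -> load c' v = 0 & 0 <= \sum_e c' e].
  have [cs|cs] := leP 0 (\sum_e c e); first by exists c.
  exists (fun e => - c e); split.
  - by case: c0 => e ce; exists e; rewrite oppr_eq0.
  - by move=> e /csupp->; rewrite oppr0.
  - by move=> v /csat; rewrite /load sumrN => ->; rewrite oppr0.
  - by rewrite sumrN oppr_ge0 ltW.
have [w' [fw' sw' ss' mw']] := fractional_matching_move fw c'0 c'supp c'sat c'sum.
have [M [Mw Md Ms]] := IH w' (leq_trans mw' mw) fw'.
exists M; split=> //; [exact: subset_trans ss' | exact: le_trans Ms].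
Qed.

End Furedi.

(** * Intervals with integer endpoints *)

Section IntegerIntervals.
Variables (d m k : nat) (lo hi : 'I_m -> 'I_d -> nat).
Local Notation I := ('I_d * 'I_k)%type.
Local Notation pt := {ffun I -> nat}.

Implicit Types (e : 'I_m) (j : 'I_d) (i : I) (p : pt).

Definition nonempty e j := lo e j <= hi e j.
Definition int_disjoint e e' :=
  [forall j, minn (hi e j) (hi e' j) < maxn (lo e j) (lo e' j)].

(* The integer picture is magnified by [2 * rad]: a grid point at distance less
   than [rad] from a magnified interval rounds to a point of the original one. *)
Definition rad := (4 * k * k.+1 * m).+1.
Definition left_end e j := 2 * rad * (lo e j).+1.
Definition right_end e j := 2 * rad * (hi e j).+1.
Definition top := 2 * rad * (\max_e \max_j hi e j).+2.

Lemma left_le_right e j : nonempty e j -> left_end e j <= right_end e j.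
Proof. by rewrite /nonempty => ej; rewrite leq_mul2l ltnS ej orbT. Qed.

Lemma right_end_lt_top e j : right_end e j < top.
Proof.
have hle : hi e j <= \max_e \max_j hi e j.
  exact: leq_trans (leq_bigmax j) (leq_bigmax (F := fun e => \max_j hi e j) e).
by rewrite ltn_mul2l /= ltnS.
Qed.

(** On an empty piece the value is the truncation level [rad], so that such a piece never lowers
    [wt]. *)
Definition dist e j t :=
  if nonempty e j then (left_end e j - t) + (t - right_end e j) else rad.

(* Distance of [e] from the points [p], truncated at [rad]; zero if [e] is hit. *)
Definition wt e p := rad - \max_i (rad - dist e i.1 (p i)).

Lemma wt_le_dist e i p : wt e p <= dist e i.1 (p i).
Proof.
have := leq_bigmax (F := fun i => rad - dist e i.1 (p i)) i.
by rewrite /wt /=; lia.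
Qed.

(** Round [p] to the nearest multiples of [2 * rad]; [.-1] undoes the shift in the endpoints. An
    edge missed by the rounded points is at distance at least [rad] from [p]. *)
Lemma exists_wt_eq_rad (p : pt) :
  (forall q : pt, exists e, forall i, ~~ (lo e i.1 <= q i <= hi e i.1)) ->
  exists e, wt e p = rad.
Proof.
move/(_ [ffun i => ((p i + rad) %/ (2 * rad)).-1])=> [e unc]; exists e.
rewrite /wt (eqP (_ : \max_i _ == 0)) ?subn0 // -leqn0; apply/bigmax_leqP => i _.
rewrite leqn0 subn_eq0 /dist; case: ifP => // ne; rewrite leqNgt.
apply: contra (unc i) => near; rewrite ffunE; move: near.
rewrite /left_end /right_end; have : 0 < rad by [].
move: (lo e _) (hi e _) ne rad (p i) => l h _ r t r0 near.
have lb : l.+1 <= (t + r) %/ (2 * r) by rewrite leq_divRL; lia.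
have ub : (t + r) %/ (2 * r) < h.+2 by rewrite ltn_divLR; lia.
by lia.
Qed.

Definition near (p q : pt) := forall i, p i <= (q i).+1 /\ q i <= (p i).+1.

Lemma in_cell_near y z : in_cell y z -> near y z /\ near z y.
Proof.
by move=> yz; split=> i; have /andP[yi zi] := yz i; have yi' := leqW yi.
Qed.

Lemma wt_lipschitz e p q : near p q -> wt e q <= (wt e p).+1.
Proof.
move=> pq; suff : \max_i (rad - dist e i.1 (p i)) <= (\max_i (rad - dist e i.1 (q i))).+1.
  by rewrite /wt; lia.
apply/bigmax_leqP => i _.
have := leq_bigmax (F := fun i => rad - dist e i.1 (q i)) i.
have := pq i; rewrite /= /dist; case: ifP => _; lia.
Qed.

Definition wt_left e i p := if nonempty e i.1 && (right_end e i.1 < p i) then wt e p else 0.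

(** When the point crosses the right end of the piece, it is within distance 1 of it, so the weight
    that appears is at most 1. *)
Lemma wt_left_lipschitz e i p q : near p q -> wt_left e i q <= (wt_left e i p).+1.
Proof.
move=> pq; rewrite /wt_left; case: ifP => // /andP[ne rq]; rewrite ne /=.
case: ifP => rp; first exact: wt_lipschitz.
apply: leq_trans (wt_le_dist e i q) _; have := pq i.
by rewrite /dist ne; have := left_le_right ne; lia.
Qed.

Definition load_left i p := \sum_e wt_left e i p.
Definition load_line j p := \sum_(e | nonempty e j) wt e p.

Lemma load_left_lipschitz i p q : near p q -> load_left i q <= load_left i p + m.
Proof.
move=> pq; rewrite /load_left -[X in _ + X]card_ord -sum1_card -big_split /=.
by apply: leq_sum => e _; rewrite addn1 wt_left_lipschitz.
Qed.

Lemma load_line_lipschitz j p q : near p q -> load_line j q <= load_line j p + m.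
Proof.
move=> pq; rewrite /load_line !(big_mkcond (fun e => nonempty e j)) /=.
rewrite -[X in _ + X]card_ord -sum1_card -big_split /=.
by apply: leq_sum => e _; rewrite addn1; case: ifP => // _; apply: wt_lipschitz.
Qed.

(* The first two cases force Kuhn's boundary conditions; the second one differs
   from the third only if the line carries no weight. *)
Definition label i p :=
  if p i == 0 then false else if top <= p i then true
  else i.2.+1 * load_line i.1 p < k.+1 * load_left i p.

Lemma label_true i p : label i p -> i.2.+1 * load_line i.1 p <= k.+1 * load_left i p.
Proof.
rewrite /label; case: eqP => // _; case: ifP => [tp _|_ /ltnW//].
suff -> : load_left i p = load_line i.1 p by rewrite leq_mul2r ltnS ltnW ?orbT.
rewrite /load_left /load_line [RHS]big_mkcond; apply: eq_bigr => e _.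
by rewrite /wt_left (leq_trans (right_end_lt_top e i.1) tp) andbT.
Qed.

Lemma label_false i p : ~~ label i p -> k.+1 * load_left i p <= i.2.+1 * load_line i.1 p.
Proof.
rewrite /label; case: eqP => [p0 _|_]; last by case: ifP => // _; rewrite -leqNgt.
by rewrite /load_left big1 ?muln0 // => e _; rewrite /wt_left p0 ltn0 andbF.
Qed.

(** Kuhn's cell has a true and a false vertex for each label. Passing from either to [y] changes
    both loads by at most [m], with coefficients at most [k.+1]. *)
Lemma balanced_point : exists y : pt, forall i,
  k.+1 * load_left i y <= i.2.+1 * load_line i.1 y + 2 * k.+1 * m /\
  i.2.+1 * load_line i.1 y <= k.+1 * load_left i y + 2 * k.+1 * m.
Proof.
have l0 i p : p i = 0 -> label i p = false by rewrite /label => ->.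
have ln i p : p i = top -> label i p = true by rewrite /label => ->; rewrite leqnn.
have [y _ yP] := kuhn l0 ln; exists y => i.
have [z [z' [lz lz' /in_cell_near[yz zy] /in_cell_near[yz' zy']]]] := yP i.
have := label_true lz; have := label_false lz'.
have := load_left_lipschitz i yz; have := load_left_lipschitz i zy'.
have := load_line_lipschitz i.1 zy; have := load_line_lipschitz i.1 yz'.
have := ltn_ord i.2; move: (load_left i _) (load_left i _) (load_left i _).
move: (load_line _ _) (load_line _ _) (load_line _ _) (nat_of_ord i.2) => b c a s A B C.
by nia.
Qed.

(** * Gaps cut out by a balanced configuration *)

Variable y : pt.

(** The points of line [j] get the indices 1 to [k], between the sentinels 0 and [top]. *)
Definition threshold j t :=
  if t is u.+1 then (if insub u is Some s then y (j, s) else top) else 0.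

Lemma threshold_ord j (s : 'I_k) : threshold j s.+1 = y (j, s).
Proof. by rewrite /threshold insubT //= => ks; congr (y (_, _)); apply: val_inj. Qed.

Lemma threshold_top j : threshold j k.+1 = top.
Proof. by rewrite /threshold insubF ?ltnn. Qed.

(** The points of [y] need not be sorted, hence the first threshold beyond the right end. *)
Definition slot e j := find (fun s => right_end e j < threshold j s.+1) (iota 0 k.+1).

Lemma has_slot e j : has (fun s => right_end e j < threshold j s.+1) (iota 0 k.+1).
Proof.
apply/hasP; exists k; first by rewrite mem_iota add0n ltnSn.
by rewrite threshold_top right_end_lt_top.
Qed.

Lemma slot_lt e j : slot e j < k.+1.
Proof. by have := has_slot e j; rewrite has_find size_iota. Qed.

Lemma right_end_lt_threshold e j : right_end e j < threshold j (slot e j).+1.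
Proof. by have := nth_find 0 (has_slot e j); rewrite nth_iota ?slot_lt. Qed.

Lemma threshold_le_right_end e j t : t <= slot e j -> threshold j t <= right_end e j.
Proof.
case: t => // t ts; have tk := ltn_trans ts (slot_lt e j).
by have := before_find 0 ts; rewrite nth_iota // add0n ltnNge => /negbFE.
Qed.

(** The threshold after [slot e j] is a point of [y] right of [e] and not beyond the right end of
    [e']; positive weight means that it misses [e'], so it lies left of [e']. *)
Lemma slot_disjoint e e' j : nonempty e' j -> 0 < wt e' y ->
  slot e j < slot e' j -> hi e j < lo e' j.
Proof.
move=> ne w0 ss; have sk : slot e j < k by have := slot_lt e' j; lia.
have := right_end_lt_threshold e j; have := threshold_le_right_end ss.
rewrite -[slot e j]/(nat_of_ord (Ordinal sk)) threshold_ord.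
set i := (j, _) => yr yl.
have /(leq_trans w0) := wt_le_dist e' i y.
rewrite /dist /= ne => d0.
have : right_end e j < left_end e' j by lia.
by rewrite ltn_mul2l ltnS.
Qed.

Definition load_slot j s := \sum_(e | nonempty e j && (slot e j == s)) wt e y.

Hypothesis balanced : forall i,
  k.+1 * load_left i y <= i.2.+1 * load_line i.1 y + 2 * k.+1 * m /\
  i.2.+1 * load_line i.1 y <= k.+1 * load_left i y + 2 * k.+1 * m.

Lemma balanced_threshold j t (A := \sum_(e | nonempty e j && (right_end e j < threshold j t)) wt e y) :
  t <= k.+1 -> k.+1 * A <= t * load_line j y + 2 * k.+1 * m /\
    t * load_line j y <= k.+1 * A + 2 * k.+1 * m.
Proof.
case: t @A => [|t] A tk.
  by rewrite /A big1 ?muln0 // => e; rewrite ltn0 andbF.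
have [tk'|kt] := ltnP t k; last first.
  have -> : t = k by lia.
  suff -> : A = load_line j y by lia.
  apply: eq_bigl => e; have -> : t = k by lia.
  by rewrite threshold_top right_end_lt_top andbT.
have := balanced (j, Ordinal tk') => /=.
suff -> : A = load_left (j, Ordinal tk') y by [].
rewrite /A big_mkcond; apply: eq_bigr => e _.
by rewrite -[t]/(nat_of_ord (Ordinal tk')) threshold_ord.
Qed.

(** Subtract the balance conditions at consecutive thresholds, which doubles the error. If these
    thresholds are out of order, the slot is empty. *)
Lemma load_slot_le j s : s <= k -> k.+1 * load_slot j s <= load_line j y + 4 * k.+1 * m.
Proof.
move=> sk.
have [lt|ge] := ltnP (threshold j s) (threshold j s.+1); last first.
  rewrite /load_slot big1 ?muln0 // => e /andP[_ /eqP es].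
  have := right_end_lt_threshold e j; have := @threshold_le_right_end e j s.
  by rewrite es; lia.
have [_ lb] := @balanced_threshold j s (leqW sk).
have [ub _] := @balanced_threshold j s.+1 sk.
suff : load_slot j s + \sum_(e | nonempty e j && (right_end e j < threshold j s)) wt e y
    <= \sum_(e | nonempty e j && (right_end e j < threshold j s.+1)) wt e y by nia.
rewrite /load_slot !(big_mkcond (fun e => _ && _)) /= -big_split /=.
apply: leq_sum => e _; case: (nonempty e j) => //=.
have [es|_] := eqVneq (slot e j) s.
  have rs := right_end_lt_threshold e j; rewrite es in rs.
  by rewrite rs ltnNge threshold_le_right_end ?es // addn0.
by case: ifP => // rs; rewrite (ltn_trans rs lt).
Qed.

Definition slots e : {set 'I_d * 'I_k.+1} :=
  [set v : 'I_d * 'I_k.+1 | nonempty e v.1 && (slot e v.1 == v.2)].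

Lemma slots_partite e : {in slots e &, injective fst}.
Proof.
move=> [j s] [j' s'] /=; rewrite !inE /= => /andP[_ /eqP es] /andP[_ /eqP es'] jj.
by subst j'; congr (_, _); apply/val_inj/(etrans (esym es) es').
Qed.

Lemma slots_int_disjoint e e' : 0 < wt e y -> 0 < wt e' y ->
  [disjoint slots e & slots e'] -> int_disjoint e e'.
Proof.
move=> we we' dis; apply/forallP=> j.
have [ne|] := boolP (nonempty e j); last by rewrite /nonempty; lia.
have [ne'|] := boolP (nonempty e' j); last by rewrite /nonempty; lia.
have : slot e j != slot e' j.
  apply/eqP=> ss; move/disjoint_setI0/setP/(_ (j, Ordinal (slot_lt e j))): dis.
  by rewrite !inE /= ne ne' ss eqxx.
rewrite neq_ltn => /orP[/(slot_disjoint ne' we')|/(slot_disjoint ne we)]; lia.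
Qed.

End IntegerIntervals.

(** * From balanced weights to a large matching *)

Section IntegerTheorem.
Local Open Scope ring_scope.

Theorem large_int_matching (d m nu : nat) (lo hi : 'I_m -> 'I_d -> nat) :
  (1 < d)%N -> (forall e, exists j, lo e j <= hi e j)%N ->
  (forall q : {ffun 'I_d * 'I_(d.-1 * nu) -> nat},
     exists e, forall i, ~~ (lo e i.1 <= q i <= hi e i.1)%N) ->
  exists2 M : {set 'I_m}, (nu < #|M|)%N &
    {in M &, forall e e', e != e' -> int_disjoint lo hi e e'}.
Proof.
move=> d2 ne unc; set k := (d.-1 * nu)%N in unc *.
have [y bal] := balanced_point k lo hi.
have [e0 we0] := exists_wt_eq_rad y unc.
pose W := \sum_e (wt lo hi e y)%:R : rat.
(* The bound of [load_slot_le] on any gap, with the line load replaced by the total weight [W]. *)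
pose Q := W / k.+1%:R + 4 * m%:R : rat.
have rad_le_W : (rad m k)%:R <= W.
  by rewrite -we0 /W (bigD1 e0) //= lerDl sumr_ge0.
have W0 : 0 < W by apply: lt_le_trans rad_le_W; rewrite ltr0n.
have k0 : 0 < k.+1%:R :> rat by rewrite ltr0n.
have Q0 : 0 < Q by rewrite ltr_wpDr ?divr_gt0 // mulr_ge0.
pose w e : rat := (wt lo hi e y)%:R / Q.
have slots0 e : slots lo hi y e != set0.
  have [j nj] := ne e; apply/set0Pn; exists (j, Ordinal (slot_lt hi y e j)).
  by rewrite inE /= eqxx andbT.
have fw : fractional_matching (slots lo hi y) w.
  split=> [e|[j s]]; first by rewrite divr_ge0 // ltW.
  rewrite /load -mulr_suml ler_pdivrMr // mul1r /Q -lerBlDr ler_pdivlMr //.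
  have := load_slot_le bal j (ltn_ord s : (s <= k)%N).
  rewrite -(@ler_nat rat) natrD !natrM /load_slot natr_sum => le_slot.
  have -> : \sum_(e | (j, s) \in slots lo hi y e) (wt lo hi e y)%:R
      = \sum_(e | nonempty lo hi e j && (slot hi y e j == s)) (wt lo hi e y)%:R :> rat.
    by apply: eq_bigl => e; rewrite inE.
  have : (load_line lo hi j y)%:R <= W.
    rewrite /load_line natr_sum /W [leRHS](bigID (fun e => nonempty lo hi e j)) /=.
    by rewrite lerDl sumr_ge0.
  by move: le_slot; rewrite mulrBl; lra.
have [M [Mw Md Ms]] := furedi_partite d2 slots0 (@slots_partite _ _ _ lo hi y) fw.
have M0 e : e \in M -> (0 < wt lo hi e y)%N.
  move/(subsetP Mw); rewrite inE lt0n; apply: contraNneq => we.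
  by rewrite /w we mul0r.
exists M; last first.
  by move=> e e' eM e'M ee; apply: (@slots_int_disjoint _ _ _ _ _ y); rewrite ?M0 ?Md.
rewrite ltnNge; apply/negP => Mnu.
have : W / Q <= k%:R.
  rewrite /W mulr_suml; apply: le_trans Ms _.
  by rewrite ler_nat leq_mul2l Mnu orbT.
rewrite ler_pdivrMr // /Q mulrDr -lerBlDl.
have -> : W - k%:R * (W / k.+1%:R) = W / k.+1%:R.
  by rewrite -natr1; field; rewrite natr1 lt0r_neq0.
(* A small matching would force [W <= 4 * k * k.+1 * m], which is [rad - 1]. *)
rewrite ler_pdivrMr //; move: rad_le_W; rewrite /rad -natr1 !natrM; lra.
Qed.

End IntegerTheorem.

(** * Real endpoints *)

Section Rank.
Variables (T : finType) (val : T -> R).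
Local Open Scope R_scope.

Definition rank (x : R) : nat := #|[set t | if Rlt_dec (val t) x then true else false]|.

Lemma rank_lt x y : (rank x < rank y)%N -> x < y.
Proof.
move=> rxy; apply: Rnot_le_lt => yx; move: rxy; rewrite ltnNge => /negP; apply.
apply/subset_leq_card/subsetP => t; rewrite !inE.
case: (Rlt_dec (val t) y) => // ty _; case: (Rlt_dec (val t) x) => // [[]].
exact: Rlt_le_trans yx.
Qed.

Lemma lt_rank t y : val t < y -> (rank (val t) < rank y)%N.
Proof.
move=> ty; apply/proper_card/properP; split.
  apply/subsetP => s; rewrite !inE.
  case: (Rlt_dec (val s) (val t)) => // st _; case: (Rlt_dec (val s) y) => // [[]].
  exact: Rlt_trans ty.
exists t; rewrite inE; first by case: (Rlt_dec (val t) y).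
by case: (Rlt_dec (val t) (val t)) => // tt'; case: (Rlt_irrefl _ tt').
Qed.

(** Take the largest value of rank at most [n]; if there is none, the condition on [s] is void. *)
Lemma exists_point_of_rank (n : nat) : exists x : R, forall s t,
  (rank (val s) <= n <= rank (val t))%N -> val s <= x <= val t.
Proof.
case: (pickP (fun t => rank (val t) <= n)%N) => [t0 t0n|none]; last first.
  by exists 0 => s t; rewrite none.
have [u un umax] := @arg_maxnP T t0 (fun t => rank (val t) <= n)%N (fun t => rank (val t)) t0n.
exists (val u) => s t /andP[sn nt]; split; apply: Rnot_lt_le => /lt_rank.
  by rewrite ltnNge [(_ <= _)%N]umax.
by rewrite ltnNge (leq_trans un nt).
Qed.

End Rank.

Lemma mem_List_In (A : eqType) (B : Type) (f : A -> B) (s : seq A) a :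
  a \in s -> List.In (f a) (map f s).
Proof.
by elim: s => //= b s IH; rewrite inE => /orP[/eqP->|/IH]; [left|right].
Qed.

(* tau(H) <= (d^2 - d) nu(H), i.e. there is a cover with at most
   (d^2 - d) * nu(H) points. *)
Theorem theorem6p3 (d : nat) (hd : 2 <= d) (m : nat) (H : 'I_m -> sdint d)
    (Hne : forall i : 'I_m, exists p : point d, in_sdint (H i) p)
    (nu : nat) (Hnu : is_nu H nu) :
  exists C : seq (point d), is_cover H C /\ size C <= (d ^ 2 - d) * nu.
Proof.
pose val (t : 'I_m * 'I_d * bool) : R :=
  if t.2 then fst (H t.1.1 t.1.2) else snd (H t.1.1 t.1.2).
pose lo e j := rank val (fst (H e j)); pose hi e j := rank val (snd (H e j)).
(* Either [d.-1 * nu] integer points per line hit all edges, or the integer theorem contradicts the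
   maximality of [nu]. *)
have [[q qP]|noq] := classic (exists q : {ffun 'I_d * 'I_(d.-1 * nu) -> nat},
    forall e, exists i, lo e i.1 <= q i <= hi e i.1); last first.
  have [||M nuM Md] := @large_int_matching d m nu lo hi hd.
  - move=> e; have [[j x] [/= lx xr]] := Hne e; exists j.
    rewrite leqNgt; apply/negP => /rank_lt rl.
    by apply: (Rlt_irrefl x); apply: Rle_lt_trans xr (Rlt_le_trans _ _ _ rl lx).
  - move=> q; apply: NNPP => cov; apply: noq; exists q => e.
    apply: NNPP => unc; apply: cov; exists e => i; apply/negP => ei.
    by apply: unc; exists i.
  have : is_matching H M.
    move=> e e' eM e'M ee [[j x] [/= [lx xr] [lx' xr']]].
    have /forallP/(_ j) := Md e e' eM e'M ee.
    rewrite gtn_min !leq_max.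
    by move=> /orP[] /orP[] /rank_lt rl; apply: (Rlt_irrefl x);
      apply: (Rle_lt_trans _ _ _ _ (Rlt_le_trans _ _ _ rl _)).
  by case: Hnu => _ /(_ M) h /h; rewrite leqNgt nuM.
(* Each integer point is pulled back to a single real point serving all edges it hits. *)
have [x xP] := fin_all_exists (fun i : 'I_d * 'I_(d.-1 * nu) =>
  exists_point_of_rank val (q i)).
exists [seq (i.1, x i) | i <- enum {: 'I_d * 'I_(d.-1 * nu)}]; split.
  move=> e; have [i ei] := qP e; exists (i.1, x i); split.
    exact: (mem_List_In (fun i => (i.1, x i)) (mem_enum _ i)).
  exact: (xP i (e, i.1, true) (e, i.1, false)).
rewrite size_map -cardE card_prod !card_ord mulnA leq_mul2r; apply/orP; right.
by case: d hd {H Hne Hnu val lo hi q qP x xP} => // d _; rewrite /= expnS expn1; nia.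
Qed.
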